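(* Let $n\ge 2$ and let $a,b,d,m$ be positive integers with $b<a$ and $d<m$. Set $r=ma$, $s=db$ and $q=R(n;a,b)-1$. Then $R(n;r,s)>A_q(m,d)$.
   Context: For positive integers $n,r,s$ with $r>s$, an $(r,s)$-coloring of $K_N$ is a map $\chi:E(K_N)\to\binom{[r]}{s}$; a monochromatic $n$-clique is a set of $n$ vertices such that all edges among them share a common color. $R(n;r,s)$ is the minimum $N$ such that every $(r,s)$-coloring of $K_N$ contains a monochromatic $n$-clique. For positive integers $q,m,d$, $A_q(m,d)$ denotes the maximum size of a code $C\subseteq[q]^m$ in which any two distinct codewords differ in at least $d$ coordinates (Hamming distance at least $d$). *)

(* Defs.v *)
From mathcomp Require Import all_boot.

Set Implicit Arguments.
Unset Strict Implicit.
Unset Printing Implicit Defensive.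

Definition edge (N : nat) := {e : {set 'I_N} | #|e| == 2}.

Definition ksubset (r s : nat) := {A : {set 'I_r} | #|A| == s}.

Definition coloring (N r s : nat) := {ffun edge N -> ksubset r s}.

Definition mono_clique (N n r s : nat) (chi : coloring N r s) (S : {set 'I_N}) :=
  (#|S| == n) &&
  [exists c : 'I_r,
     forall e : edge N, (val e \subset S) ==> (c \in val (chi e))].

Definition forces_clique (n r s N : nat) : bool :=
  [forall chi : coloring N r s, exists S, mono_clique n chi S].

(* Multicolour Ramsey theorem for multi-valued colourings [g] of pairs, with a
   prescribed clique size [k c] for each colour. *)
Lemma ramsey_cliques (r : nat) (k : 'I_r -> nat) :
  exists M, forall (T : finType) (g : T -> T -> pred 'I_r) (V : {set T}),
    (forall x y c, g x y c -> g y x c) ->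
    (forall x y, x != y -> exists c, g x y c) ->
    M <= #|V| ->
    exists c, exists S : {set T}, [/\ S \subset V, #|S| = k c &
      {in S &, forall x y, x != y -> g x y c}].
Proof.
have [w] := ubnP (\sum_c k c); elim: w => // w IH in k *.
rewrite ltnS => le_k.
have [/existsP[c0 /eqP k0]|/existsPn kN0] := boolP [exists c, k c == 0].
  exists 0 => T g V _ _ _; exists c0, set0; rewrite sub0set cards0 k0.
  by split=> // x y; rewrite inE.
pose k' c c' := if c' == c then (k c').-1 else k c'.
have ltk' c : \sum_c' k' c c' < w.
  apply: leq_trans le_k; rewrite (bigD1 c) //= [ltnRHS](bigD1 c) //= /k' eqxx.
  rewrite -addSn prednK ?lt0n // leq_add2l.
  by apply: leq_sum => c' /negPf ->.
have [M HM] := fin_all_exists (fun c => IH (k' c) (ltk' c)).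
exists (\sum_c M c).+2 => T g V gC g_ex leV.
have [x Vx] : exists x, x \in V by apply/card_gt0P; apply: leq_trans leV.
pose W c := [set y in V :\ x | g x y c].
have [c leW] : exists c, M c <= #|W c|.
  apply/existsP; apply: contraT => /existsPn Wlt.
  have : #|V :\ x| <= \sum_c M c.
    apply: (@leq_trans (\sum_c #|W c|)); last first.
      by apply: leq_sum => c _; rewrite ltnW // ltnNge Wlt.
    apply: (@leq_trans #|\bigcup_c W c|).
      apply/subset_leq_card/subsetP => y Vy.
      have [c gc] : exists c, g x y c.
        by apply: g_ex; move: Vy; rewrite !inE eq_sym => /andP[].
      by apply/bigcupP; exists c; rewrite // inE Vy.
    elim/big_ind2: _ => [|m A p B le1 le2|//]; first by rewrite cards0.
    by apply: leq_trans (leq_card_setU _ _) (leq_add le1 le2).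
  by move: leV; rewrite (cardsD1 x) Vx add1n ltnS leqNgt ltnS => /negP.
have [c' [S [sSW cS gS]]] := HM c T g (W c) gC g_ex leW.
have sSV : S \subset V.
  by apply: subset_trans sSW _; apply/subsetP=> y; rewrite !inE -!andbA => /and3P[].
exists c'; move: cS; rewrite /k'; case: eqP => [def_c' | _] cS; last first.
  by exists S.
rewrite {c'}def_c' in cS gS *.
have xS y : y \in S -> g x y c by move/(subsetP sSW); rewrite inE => /andP[].
have NSx : x \notin S by apply/negP=> /(subsetP sSW); rewrite !inE eqxx.
exists (x |: S); split.
- by rewrite subUset sub1set Vx.
- by rewrite cardsU1 NSx cS add1n prednK // lt0n.
move=> y z /setU1P[->|Sy] /setU1P[->|Sz] neq.
- by rewrite eqxx in neq.
- exact: xS.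
- exact/gC/xS.
- exact: gS.
Qed.

Lemma ramsey_exists (n r s : nat) : 0 < s -> exists N, forces_clique n r s N.
Proof.
move=> s_gt0; have [N HN] := ramsey_cliques (fun _ : 'I_r => n).
exists N; apply/forallP => chi.
pose g (x y : 'I_N) (c : 'I_r) :=
  [exists e : edge N, (val e == [set x; y]) && (c \in val (chi e))].
have gC x y c : g x y c -> g y x c by rewrite /g setUC.
have g_ex x y : x != y -> exists c, g x y c.
  move=> neq; have e2 : #|[set x; y]| == 2 by rewrite cards2 neq.
  pose e : edge N := Sub [set x; y] e2.
  have /card_gt0P[c chi_c] : 0 < #|val (chi e)| by rewrite (eqP (valP (chi e))).
  by exists c; apply/existsP; exists e; rewrite eqxx.
have [|c [S [_ cS gS]]] := HN _ g setT gC g_ex; first by rewrite cardsT card_ord.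
apply/existsP; exists S; rewrite /mono_clique cS eqxx /=.
apply/existsP; exists c; apply/forallP => e; apply/implyP => sub.
have /cards2P[x [y [neq def_e]]] := valP e.
have /gS : x \in S by rewrite (subsetP sub) // def_e !inE eqxx.
move=> /(_ y); rewrite (subsetP sub) ?def_e ?inE ?eqxx ?orbT //.
move=> /(_ isT neq) /existsP[e' /andP[/eqP def_e' chi_c]].
by have -> : e = e' by apply: val_inj; rewrite def_e def_e'.
Qed.

(* R(n; r, s).  The number need not exist when [s = 0] (edges then carry no
   colour), where the value is set to 0. *)
Definition ramsey (n r s : nat) : nat :=
  if s is s'.+1 then ex_minn (ramsey_exists n r (ltn0Sn s')) else 0.

Definition hamming (q m : nat) (x y : {ffun 'I_m -> 'I_q}) : nat :=
  #|[set i | x i != y i]|.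

Definition is_code (q m d : nat) (C : {set {ffun 'I_m -> 'I_q}}) : bool :=
  [forall x in C, forall y in C, (x != y) ==> (d <= hamming x y)].

(* A_q(m, d) *)
Definition max_code (q m d : nat) : nat :=
  \max_(C : {set {ffun 'I_m -> 'I_q}} | is_code d C) #|C|.

(* Main.v *)
Require Import Defs.
From mathcomp Require Import all_boot.

(** Label the vertices of [K_N] by distinct codewords.  On [q] vertices there is
    an [(a,b)]-colouring without monochromatic [n]-clique; colour an edge of
    [K_N] by the pairs [(i, c)], where [i] runs over [d] coordinates in which the
    two codewords differ and [c] over the [b] colours of the edge joining their
    [i]-th letters.  On a clique of colour [(i, c)] the [i]-th letter is
    injective, and it maps the clique to one of colour [c] in [K_q]. *)

Lemma subset_of_card (T : finType) (A : {set T}) (k : nat) :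
  k <= #|A| -> exists2 B : {set T}, B \subset A & #|B| = k.
Proof.
case/card_geqP=> s [s_uniq <- sA]; exists [set:: s].
  by apply/subsetP=> x; rewrite inE => /sA.
by rewrite cardsE; apply/card_uniqP.
Qed.

Lemma forces_cliquePn (n r s N : nat) :
  reflect (exists chi : coloring N r s, forall S, ~~ mono_clique n chi S)
          (~~ forces_clique n r s N).
Proof.
apply: (iffP forallPn) => -[chi noS]; exists chi; first exact/existsPn.
by apply/existsPn.
Qed.

(** Makes the Ramsey numbers positive, so that subtracting 1 from them is never truncated. *)
Lemma forces_clique0 (n r s : nat) : 0 < n -> ~~ forces_clique n r s 0.
Proof.
move=> n_gt0; apply/forces_cliquePn.
(* Without edges there is a unique colouring, the empty one, whatever [r] and [s] are. *)
have no_edge (e : edge 0) : False by case/cards2P: (valP e) => -[].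
exists [ffun e => False_rect _ (no_edge e)] => S.
have /eqP S0 : #|S| == 0 by rewrite -leqn0 -[X in _ <= X](card_ord 0) max_card.
by rewrite /mono_clique S0 eq_sym (gtn_eqF n_gt0).
Qed.

Lemma ramsey_forces (n r s : nat) :
  0 < s -> forces_clique n r s (ramsey n r s).
Proof. by case: s => // s _; rewrite /ramsey; case: ex_minnP. Qed.

Lemma lt_ramsey_not_forces (n r s N : nat) :
  N < ramsey n r s -> ~~ forces_clique n r s N.
Proof.
case: s => // s; rewrite /ramsey; case: ex_minnP => R _ minR ltNR.
by apply: contraL ltNR => /minR; rewrite -leqNgt.
Qed.

Lemma ramsey_gt0 (n r s : nat) : 0 < n -> 0 < s -> 0 < ramsey n r s.
Proof.
move=> n_gt0 /(ramsey_forces n r); case: ramsey => //.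
by rewrite (negPf (forces_clique0 _ _ _ n_gt0)).
Qed.

(** Any [N] up to the size of the code is allowed, so that the theorem can take [N] to be the Ramsey
    number itself. *)
Lemma code_not_forces (n a b q m d N : nat) (C : {set {ffun 'I_m -> 'I_q}}) :
  is_code d C -> N <= #|C| -> ~~ forces_clique n a b q ->
  ~~ forces_clique n (m * a) (d * b) N.
Proof.
move=> codeC leNC /forces_cliquePn[chi0 no_clique]; apply/forces_cliquePn.
pose w (v : 'I_N) := enum_val (widen_ord leNC v).
have w_inj : injective w.
  by move=> u v /enum_val_inj /(congr1 val) /= /val_inj.
have dist_w u v : u != v -> d <= #|[set i | w u i != w v i]|.
  move=> neq; move/forall_inP: codeC => /(_ _ (enum_valP (widen_ord leNC u))).
  move/forall_inP=> /(_ _ (enum_valP (widen_ord leNC v))) /implyP; apply.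
  by rewrite (inj_eq w_inj).
have cardK : m * a = #|{: 'I_m * 'I_a}| by rewrite card_prod !card_ord.
pose h (k : 'I_(m * a)) : 'I_m * 'I_a := enum_val (cast_ord cardK k).
have h_inj : injective h by move=> k l /enum_val_inj /cast_ord_inj.
have h_bij : bijective h by apply: inj_card_bij; rewrite // card_ord cardK.
(* Taking the image of the whole edge under the [i]-th letter avoids ordering its endpoints. *)
have choose_colours (e : edge N) : exists A : ksubset (m * a) (d * b),
    forall k, k \in val A -> exists2 e0 : edge q,
      val e0 = (fun v => w v (h k).1) @: val e & (h k).2 \in val (chi0 e0).
  have /cards2P[u [v [neq def_e]]] := valP e.
  (* The codewords may differ in more than [d] places; keeping exactly [d] gives exactly [d * b]
     colours. *)
  have [D sD cardD] := subset_of_card _ _ _ (dist_w u v neq).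
  (* The default [set0] occurs only where the letters agree, hence never for [i] in [D]. *)
  pose g (i : 'I_m) : {set 'I_a} :=
    if insub [set w u i; w v i] is Some e0 then val (chi0 e0) else set0.
  pose B := [set p : 'I_m * 'I_a | (p.1 \in D) && (p.2 \in g p.1)].
  have gD i : i \in D -> exists2 e0 : edge q,
      val e0 = [set w u i; w v i] & g i = val (chi0 e0).
    move/(subsetP sD); rewrite inE /g => neqi.
    case: insubP => [e0 _ def_e0 | ]; first by exists e0.
    by rewrite cards2 neqi.
  have cardB : #|B| = d * b.
    rewrite -sum1dep_card.
    rewrite -(pair_big_dep (fun i => i \in D) (fun i c => c \in g i) (fun _ _ => 1)).
    rewrite -cardD -sum_nat_const; apply: eq_bigr => i /gD[e0 _ ->].
    by rewrite sum1_card; apply/eqP/(valP (chi0 e0)).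
  have cardA : #|h @^-1: B| == d * b by rewrite on_card_preimset ?cardB //; apply: onW_bij.
  exists (Sub (h @^-1: B) cardA) => k; rewrite SubK !inE => /andP[/gD[e0 def_e0 ->]].
  by exists e0; rewrite // def_e0 def_e imsetU1 imset_set1.
have [chi chiP] := fin_all_exists choose_colours.
exists (finfun chi) => S; apply/negP => /andP[/eqP cardS /existsP[k /forallP monoS]].
pose p v := w v (h k).1.
have monoE (e : edge N) : val e \subset S -> exists2 e0 : edge q,
    val e0 = p @: val e & (h k).2 \in val (chi0 e0).
  by move=> sub; have := implyP (monoS e) sub; rewrite ffunE => /chiP.
have pair_edge u v : u \in S -> v \in S -> u != v ->
    exists2 e0 : edge q, val e0 = [set p u; p v] & (h k).2 \in val (chi0 e0).
  move=> Su Sv neq; have card2 : #|[set u; v]| == 2 by rewrite cards2 neq.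
  have [|e0 def_e0 e0k] := monoE (Sub [set u; v] card2).
    by rewrite SubK subUset !sub1set Su.
  by exists e0; rewrite // def_e0 SubK imsetU1 imset_set1.
(* Equal letters would make the image of the edge a singleton, but it is an edge of [K_q]. *)
have p_inj : {in S &, injective p}.
  move=> u v Su Sv eq_p; apply/eqP; apply: contraT => neq.
  have [e0 def_e0 _] := pair_edge u v Su Sv neq.
  by have := valP e0; rewrite def_e0 eq_p setUid cards1.
have /negP[] := no_clique (p @: S); rewrite /mono_clique card_in_imset // cardS eqxx.
apply/existsP; exists (h k).2; apply/forallP=> e0; apply/implyP => sub.
have /cards2P[x [y [neq def_e0]]] := valP e0.
move: sub; rewrite def_e0 subUset !sub1set => /andP[/imsetP[u Su def_x] /imsetP[v Sv def_y]].
have neq_uv : u != v by apply: contra neq => /eqP def_u; rewrite def_x def_y def_u.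
have [e1 def_e1 e1k] := pair_edge u v Su Sv neq_uv.
by have -> : e0 = e1 by apply: val_inj; rewrite def_e0 def_e1 def_x def_y.
Qed.

Theorem theorem2p1 (n a b d m : nat) (hn : 2 <= n)
    (ha : 0 < a) (hb : 0 < b) (hd : 0 < d) (hm : 0 < m)
    (hba : b < a) (hdm : d < m) :
  ramsey n (m * a) (d * b) > max_code (ramsey n a b - 1) m d.
Proof.
have n_gt0 : 0 < n by apply: ltnW.
have db_gt0 : 0 < d * b by rewrite muln_gt0 hd.
have R_gt0 := ramsey_gt0 n (m * a) _ n_gt0 db_gt0.
rewrite -(prednK R_gt0) ltnS; apply/bigmax_leqP => C codeC.
(* A code with at least [ramsey n (m * a) (d * b)] words would give a clique-free colouring on that
   many vertices. *)
rewrite -ltnS (prednK R_gt0) ltnNge; apply/negP => leRC.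
have q_bad : ~~ forces_clique n a b (ramsey n a b - 1).
  by apply: lt_ramsey_not_forces; rewrite subn1 prednK // ramsey_gt0.
have /negP[] := code_not_forces _ _ _ _ _ _ _ _ codeC leRC q_bad.
exact: ramsey_forces.
Qed.
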